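(* Let $M\in\mathbb{R}^{m\times n}_+$ be a nonnegative matrix. For every constant $\epsilon>0$, $\|M-VW\|_F$ is nonincreasing under $$V\leftarrow\max\Big(\epsilon,\,V\circ\frac{[MW^T]}{[VWW^T]}\Big),\qquad W\leftarrow\max\Big(\epsilon,\,W\circ\frac{[V^TM]}{[V^TVW]}\Big)$$ for any $(V,W)\ge\epsilon$, with $V\in\mathbb{R}^{m\times r}$, $W\in\mathbb{R}^{r\times n}$. Moreover, every limit point of the algorithm that alternately applies these two updates is a stationary point of the optimization problem $$\min_{V\ge\epsilon,\;W\ge\epsilon}\ \|M-VW\|_F^2 .$$
   Context: $\circ$ is the component-wise product, $\frac{[A]}{[B]}$ is component-wise division, and $\max(\epsilon,\cdot)$ and the inequalities $\ge\epsilon$ are entrywise. ''Nonincreasing'' means that applying the first update ($W$ fixed) or the second update ($V$ fixed) does not increase $\|M-VW\|_F$. The algorithm starts from some $(V^0,W^0)\ge\epsilon$ and generates a sequence $\{(V^k,W^k)\}$ by alternating the two updates; a limit point is the limit of a convergent subsequence. A stationary point is a point satisfying the first-order (KKT) conditions of the problem: with $f(V,W)=\|M-VW\|_F^2$, one has $V\ge\epsilon$, $\nabla_Vf\ge\mathbf 0$, $(V_{ik}-\epsilon)(\nabla_Vf)_{ik}=0$ for all $i,k$, and likewise for $W$. *)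

(* Defs.v *)
From mathcomp Require Import all_boot all_order all_algebra.
From mathcomp Require Import all_classical all_reals all_analysis.

Set Implicit Arguments.
Unset Strict Implicit.
Unset Printing Implicit Defensive.

Import Order.TTheory GRing.Theory Num.Theory.
Import numFieldNormedType.Exports.

Local Open Scope classical_set_scope.
Local Open Scope ring_scope.

Definition entrywise_ge (R : realType) (m n : nat) (c : R) (A : 'M[R]_(m, n)) :
    Prop :=
  forall i j, c <= A i j.

(* The library norm on matrices is the max norm, hence this definition. *)
Definition frobenius (R : realType) (m n : nat) (A : 'M[R]_(m, n)) : R :=
  Num.sqrt (\sum_(i < m) \sum_(j < n) A i j ^+ 2).

Definition updateV (R : realType) (m n r : nat) (eps : R) (M : 'M[R]_(m, n))
    (V : 'M[R]_(m, r)) (W : 'M[R]_(r, n)) : 'M[R]_(m, r) :=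
  \matrix_(i, k)
    Num.max eps (V i k * ((M *m W^T) i k / (V *m W *m W^T) i k)).

Definition updateW (R : realType) (m n r : nat) (eps : R) (M : 'M[R]_(m, n))
    (V : 'M[R]_(m, r)) (W : 'M[R]_(r, n)) : 'M[R]_(r, n) :=
  \matrix_(k, j)
    Num.max eps (W k j * ((V^T *m M) k j / (V^T *m V *m W) k j)).

(* The W-update uses the V that has just been computed. *)
Definition nmf_step (R : realType) (m n r : nat) (eps : R) (M : 'M[R]_(m, n))
    (VW : 'M[R]_(m, r) * 'M[R]_(r, n)) : 'M[R]_(m, r) * 'M[R]_(r, n) :=
  let V' := updateV eps M VW.1 VW.2 in (V', updateW eps M V' VW.2).

Definition nmf_seq (R : realType) (m n r : nat) (eps : R) (M : 'M[R]_(m, n))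
    (V0 : 'M[R]_(m, r)) (W0 : 'M[R]_(r, n)) (k : nat) :
    'M[R]_(m, r) * 'M[R]_(r, n) :=
  iter k (nmf_step eps M) (V0, W0).

Definition subseq_limit (T : topologicalType) (u : nat -> T) (l : T) : Prop :=
  exists2 phi : nat -> nat, increasing_seq phi & (u \o phi) @ \oo --> l.

Definition nmf_objective (R : realType) (m n r : nat) (M : 'M[R]_(m, n))
    (V : 'M[R]_(m, r)) (W : 'M[R]_(r, n)) : R :=
  frobenius (M - V *m W) ^+ 2.

Definition mx_gradient (R : realType) (m n : nat) (f : 'M[R]_(m, n) -> R)
    (A : 'M[R]_(m, n)) : 'M[R]_(m, n) :=
  \matrix_(i, j) 'D_(delta_mx i j) f A.

Definition bound_KKT (R : realType) (m n : nat) (eps : R)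
    (f : 'M[R]_(m, n) -> R) (A : 'M[R]_(m, n)) : Prop :=
  [/\ entrywise_ge eps A,
      entrywise_ge 0 (mx_gradient f A) &
      forall i j, (A i j - eps) * mx_gradient f A i j = 0].

Definition nmf_stationary (R : realType) (m n r : nat) (eps : R)
    (M : 'M[R]_(m, n)) (V : 'M[R]_(m, r)) (W : 'M[R]_(r, n)) : Prop :=
  bound_KKT eps (fun X => nmf_objective M X W) V /\
  bound_KKT eps (fun Y => nmf_objective M V Y) W.

(* Main.v *)
(* For fixed W put Q = W W^T. In each row of V the objective is a quadratic with
   Hessian 2 Q, and it is majorised by the separable quadratic with coefficients
   c_k = (V Q)_k / V_k, whose minimiser over [eps, +oo[ is exactly the update. As
   c_k >= Q_kk >= eps^2, a step decreases the objective by at least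
   eps^2 |V' - V|^2; transposition gives the same for W. The decrements of a
   nonincreasing nonnegative sequence tend to 0, hence so do the successive
   differences of the iterates, and by continuity of the updates a limit point is
   fixed by both of them. A fixed point of an update satisfies the KKT conditions.
   If m = 0 or n = 0 the denominators vanish (and x / 0 = 0), but the objective
   is then constant. *)
Require Import Defs.
From mathcomp Require Import all_boot all_order all_algebra.
From mathcomp Require Import all_classical all_reals all_analysis.
From mathcomp Require Import ring lra.
Import Order.TTheory GRing.Theory Num.Theory.
Import numFieldNormedType.Exports.
Local Open Scope classical_set_scope.
Local Open Scope ring_scope.

(** * Frobenius inner product *)

Definition mxdot {R : realType} {m n : nat} (A B : 'M[R]_(m, n)) : R :=
  \sum_i \sum_j A i j * B i j.

Section Mxdot.
Context {R : realType}.

Lemma mxdotC {m n : nat} (A B : 'M[R]_(m, n)) : mxdot A B = mxdot B A.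
Proof. by apply: eq_bigr => i _; apply: eq_bigr => j _; rewrite mulrC. Qed.

Lemma mxdotDr {m n : nat} (A B C : 'M[R]_(m, n)) :
  mxdot A (B + C) = mxdot A B + mxdot A C.
Proof.
rewrite -big_split; apply: eq_bigr => i _.
by rewrite -big_split; apply: eq_bigr => j _; rewrite mxE mulrDr.
Qed.

Lemma mxdotZr {m n : nat} (a : R) (A B : 'M[R]_(m, n)) :
  mxdot A (a *: B) = a * mxdot A B.
Proof.
rewrite mulr_sumr; apply: eq_bigr => i _; rewrite mulr_sumr.
by apply: eq_bigr => j _; rewrite mxE mulrCA.
Qed.

Lemma mxdotZl {m n : nat} (a : R) (A B : 'M[R]_(m, n)) :
  mxdot (a *: A) B = a * mxdot A B.
Proof. by rewrite mxdotC mxdotZr mxdotC. Qed.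

Lemma mxdotNr {m n : nat} (A B : 'M[R]_(m, n)) : mxdot A (- B) = - mxdot A B.
Proof. by rewrite -scaleN1r mxdotZr mulN1r. Qed.

Lemma mxdot_delta {m n : nat} (i : 'I_m) (j : 'I_n) (A : 'M[R]_(m, n)) :
  mxdot (delta_mx i j) A = A i j.
Proof.
rewrite /mxdot (bigD1 i) //= (bigD1 j) //= !mxE !eqxx mul1r.
rewrite big1 ?addr0 => [|l lj]; last by rewrite mxE (negPf lj) andbF mul0r.
rewrite big1 ?addr0 // => k ki.
by rewrite big1 // => l _; rewrite mxE (negPf ki) mul0r.
Qed.

Lemma mxdot_trmx {m n : nat} (A B : 'M[R]_(m, n)) : mxdot A^T B^T = mxdot A B.
Proof.
rewrite /mxdot exchange_big; apply: eq_bigr => i _.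
by apply: eq_bigr => j _; rewrite !mxE.
Qed.

(** Right multiplication by [W^T] is the adjoint of right multiplication by [W]; this turns the
    cross term of the objective into a pairing with its gradient. *)
Lemma mxdot_mulmxl (m n r : nat) (D : 'M[R]_(m, r)) (W : 'M[R]_(r, n))
    (A : 'M[R]_(m, n)) :
  mxdot (D *m W) A = mxdot D (A *m W^T).
Proof.
apply: eq_bigr => i _.
under eq_bigr => j _ do rewrite mxE mulr_suml.
rewrite exchange_big; apply: eq_bigr => k _.
rewrite mxE mulr_sumr; apply: eq_bigr => j _.
by rewrite mxE; ring.
Qed.

(** Carries smallness of a step in norm over to each entry. *)
Lemma sqr_le_mxdot {m n : nat} (A : 'M[R]_(m, n)) (i : 'I_m) (j : 'I_n) :
  A i j ^+ 2 <= mxdot A A.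
Proof.
rewrite /mxdot (bigD1 i) //= (bigD1 j) //= -expr2 -addrA lerDl.
apply: addr_ge0; first by apply: sumr_ge0 => *; exact: sqr_ge0.
by apply: sumr_ge0 => *; apply: sumr_ge0 => *; exact: sqr_ge0.
Qed.

Lemma mxdot_ge0 {m n : nat} (A : 'M[R]_(m, n)) : 0 <= mxdot A A.
Proof. by apply: sumr_ge0 => *; apply: sumr_ge0 => *; exact: sqr_ge0. Qed.

Lemma mxdot_sqrB {m n : nat} (A B : 'M[R]_(m, n)) :
  mxdot (A - B) (A - B) = mxdot A A - mxdot B A *+ 2 + mxdot B B.
Proof.
rewrite mxdotDr mxdotNr !(mxdotC (A - B)) !mxdotDr !mxdotNr (mxdotC A B).
by rewrite mulr2n; ring.
Qed.

End Mxdot.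

(** * Quadratic expansion and gradient of the objective *)

Section Objective.
Context {R : realType}.

Lemma frobenius_mxdot (p q : nat) (A : 'M[R]_(p, q)) :
  frobenius A = Num.sqrt (mxdot A A).
Proof. by []. Qed.

Lemma nmf_objectiveE {m n r : nat} (M : 'M[R]_(m, n))
    (V : 'M[R]_(m, r)) (W : 'M[R]_(r, n)) :
  nmf_objective M V W = mxdot (M - V *m W) (M - V *m W).
Proof. by rewrite /nmf_objective frobenius_mxdot sqr_sqrtr ?mxdot_ge0. Qed.

(** Transposition exchanges the two factors, so statements about [updateW] can be deduced from those
    about [updateV]. *)
Lemma nmf_objective_trmx {m n r : nat} (M : 'M[R]_(m, n))
    (V : 'M[R]_(m, r)) (W : 'M[R]_(r, n)) :
  nmf_objective M^T W^T V^T = nmf_objective M V W.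
Proof. by rewrite !nmf_objectiveE -trmx_mul -linearB mxdot_trmx. Qed.

(** The expansion is exact because the residual is affine in the left factor; the linear coefficient
    is the gradient and the Hessian comes from [W *m W^T]. *)
Lemma nmf_objective_add {m n r : nat} (M : 'M[R]_(m, n))
    (V D : 'M[R]_(m, r)) (W : 'M[R]_(r, n)) :
  nmf_objective M (D + V) W = nmf_objective M V W +
    mxdot D (V *m W *m W^T - M *m W^T) *+ 2 + mxdot D (D *m (W *m W^T)).
Proof.
rewrite !nmf_objectiveE mulmxDl opprD addrCA addrC mxdot_sqrB.
rewrite mxdot_mulmxl mxdot_mulmxl mulmxBl -mulmxA.
by rewrite -(opprB (V *m _ *m _)) mxdotNr mulNrn opprK.
Qed.

(** For [h != 0] the difference quotient equals [p + h * q], which tends to [p]. *)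
Lemma derive_quadratic (U : normedModType R) (f : U -> R) (a v : U) (p q : R) :
  (forall h : R, f (h *: v + a) = f a + h * p + h ^+ 2 * q) -> 'D_v f a = p.
Proof.
move=> fE; rewrite /derive; apply: cvg_lim => //.
have pq : (fun h : R => p + h * q) @ 0^' --> p.
  rewrite -[X in _ --> X]addr0 -[X in _ --> _ + X](mul0r q).
  apply: cvgD; first exact: cvg_cst.
  by apply: cvgM; [exact: nbhs_dnbhs|exact: cvg_cst].
apply: cvg_trans pq; apply: near_eq_cvg; near=> h.
have h0 : h != 0 by near: h; exact: nbhs_dnbhs_neq.
rewrite /= fE /GRing.scale /=; field.
exact: h0.
Unshelve. all: by end_near. Qed.

Lemma nmf_gradient {m n r : nat} (M : 'M[R]_(m, n))
    (V : 'M[R]_(m, r)) (W : 'M[R]_(r, n)) :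
  mx_gradient (fun X => nmf_objective M X W) V =
  (V *m W *m W^T - M *m W^T) *+ 2.
Proof.
apply/matrixP => i k; rewrite mxE.
apply: (@derive_quadratic _ _ _ _ _
  (mxdot (delta_mx i k) (delta_mx i k *m (W *m W^T)))) => h.
rewrite nmf_objective_add -scalemxAl !mxdotZl mxdotZr !mxdot_delta.
by rewrite mulmxnE mulrnAr expr2 mulrA.
Qed.

End Objective.

(** * Sufficient decrease of the updates *)

Section Descent.
Context {R : realType}.

(* AM-GM on each pair of coordinates:
   [2 d k * d l <= d k ^ 2 * v l / v k + d l ^ 2 * v k / v l]. *)
Lemma quadratic_form_le_diag (r : nat) (Q : 'I_r -> 'I_r -> R)
    (v d : 'I_r -> R) :
  (forall k l, Q k l = Q l k) -> (forall k l, 0 <= Q k l) ->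
  (forall k, 0 < v k) ->
  \sum_k d k * (\sum_l d l * Q l k) <=
  \sum_k d k ^+ 2 * ((\sum_l v l * Q l k) / v k).
Proof.
move=> Qsym Q0 v0.
pose T k l := d k ^+ 2 * (v l * Q l k / v k).
have -> : \sum_k d k ^+ 2 * ((\sum_l v l * Q l k) / v k) =
          \sum_k \sum_l T k l.
  by apply: eq_bigr => k _; rewrite mulr_suml mulr_sumr.
(* After doubling, one copy of the right-hand sum can have its indices exchanged, which brings
   together the two terms of each AM-GM pair. *)
suff H : (\sum_k d k * (\sum_l d l * Q l k)) *+ 2 <=
         (\sum_k \sum_l T k l) *+ 2 by rewrite lerMn2r in H.
rewrite [leRHS]mulr2n {2}exchange_big -big_split -sumrMnl /=.
apply: ler_sum => k _; rewrite mulr_sumr -sumrMnl -big_split /=.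
apply: ler_sum => l _; rewrite /T (Qsym k l) -subr_ge0.
have vk := v0 k; have vl := v0 l.
suff -> : d k ^+ 2 * (v l * Q l k / v k) + d l ^+ 2 * (v k * Q l k / v l) -
    d k * (d l * Q l k) *+ 2 =
    Q l k * (d k * v l - d l * v k) ^+ 2 / (v k * v l).
  by apply: divr_ge0; apply: mulr_ge0; rewrite ?sqr_ge0 ?(ltW vk) ?(ltW vl).
by field; rewrite !gt_eqF.
Qed.

(* [x] is the minimiser on [eps, +oo[ of the majorant
   [2 (x - v) (a - b) + (x - v) ^ 2 a / v]. *)
Lemma majorant_minimizer (eps v a b x : R) :
  0 < eps -> eps <= v -> 0 < a ->
  x = Num.max eps (v * (b / a)) ->
  (x - v) * (a - b) *+ 2 + (x - v) ^+ 2 * (a / v) <= - ((x - v) ^+ 2 * (a / v)).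
Proof.
move=> eps0 epsv a0 xE; have v0 := lt_le_trans eps0 epsv.
(* This product is the slack of the claim. It is nonnegative because [x] is the projection of
   [v * (b / a)] onto [[eps, +oo[], an interval that contains [v]. *)
suff : 0 <= (v - x) * (x - v * (b / a)) * (a / v) *+ 2.
  rewrite -(subr_ge0 (_ *+ 2 + _)) => /le_trans; apply; rewrite le_eqVlt.
  by apply/orP; left; apply/eqP; field; rewrite !gt_eqF.
apply/mulrn_wge0/mulr_ge0; last by rewrite divr_ge0 // ltW.
rewrite xE; have [_|xlt] := leP eps (v * (b / a)); first by rewrite subrr mulr0.
by rewrite mulr_ge0 // subr_ge0 // ltW.
Qed.

Lemma updateV_ge {m n r : nat} (eps : R) (M : 'M[R]_(m, n))
    (V : 'M[R]_(m, r)) (W : 'M[R]_(r, n)) :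
  entrywise_ge eps (updateV eps M V W).
Proof. by move=> i k; rewrite mxE le_max lexx. Qed.

Lemma updateW_trmx {m n r : nat} (eps : R) (M : 'M[R]_(m, n))
    (V : 'M[R]_(m, r)) (W : 'M[R]_(r, n)) :
  updateW eps M V W = (updateV eps M^T W^T V^T)^T.
Proof.
have MV : M^T *m V^T^T = (V^T *m M)^T by rewrite trmx_mul.
have WV : W^T *m V^T *m V^T^T = (V^T *m V *m W)^T.
  by rewrite -mulmxA !trmx_mul.
apply/matrixP => k j; rewrite /updateW /updateV MV WV.
rewrite [LHS]mxE [RHS]mxE [RHS]mxE.
by congr (Num.max _ (_ * (_ / _))); rewrite [RHS]mxE.
Qed.

Lemma entrywise_ge_trmx {m n : nat} (c : R) (A : 'M[R]_(m, n)) :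
  entrywise_ge c A -> entrywise_ge c A^T.
Proof. by move=> Ac i j; rewrite mxE. Qed.

(** One column already contributes [eps ^+ 2] and the others contribute nonnegative products;
    [0 < n] supplies that column. *)
Lemma gram_ge {n r : nat} (eps : R) (W : 'M[R]_(r, n)) (k l : 'I_r) :
  (0 < n)%N -> 0 < eps -> entrywise_ge eps W ->
  eps ^+ 2 <= (W *m W^T) k l.
Proof.
case: n W => // n W _ eps0 Wge; rewrite mxE (bigD1 ord0) //= expr2.
rewrite mxE -[leLHS]addr0; apply: lerD.
  by rewrite ler_pM ?(ltW eps0).
apply: sumr_ge0 => j _; rewrite mxE.
by rewrite mulr_ge0 // (le_trans (ltW eps0)).
Qed.

(** The diagonal term of the product with [W *m W^T] gives the bound, the other terms being
    nonnegative. It makes the denominator positive and bounds the majorant coefficients from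
    below. *)
Lemma denominator_ge {m n r : nat} (eps : R) (V : 'M[R]_(m, r))
    (W : 'M[R]_(r, n)) (i : 'I_m) (k : 'I_r) :
  (0 < n)%N -> 0 < eps -> entrywise_ge eps V -> entrywise_ge eps W ->
  V i k * eps ^+ 2 <= (V *m W *m W^T) i k.
Proof.
move=> n0 eps0 Vge Wge; have V0 l : 0 <= V i l.
  by rewrite (le_trans (ltW eps0)).
rewrite -mulmxA mxE (bigD1 k) //= -[leLHS]addr0; apply: lerD.
  by rewrite ler_wpM2l // gram_ge.
apply: sumr_ge0 => l _; rewrite mulr_ge0 //.
by rewrite (le_trans (sqr_ge0 eps)) // gram_ge.
Qed.

Lemma updateV_decrease {m n r : nat} (eps : R) (M : 'M[R]_(m, n))
    (V : 'M[R]_(m, r)) (W : 'M[R]_(r, n)) :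
  (0 < n)%N -> 0 < eps -> entrywise_ge eps V -> entrywise_ge eps W ->
  nmf_objective M (updateV eps M V W) W +
    eps ^+ 2 * mxdot (updateV eps M V W - V) (updateV eps M V W - V) <=
  nmf_objective M V W.
Proof.
move=> n0 eps0 Vge Wge; set D := updateV eps M V W - V.
have V0 i k : 0 < V i k by exact: lt_le_trans eps0 (Vge i k).
rewrite -[updateV _ _ _ _](subrK V) -/D nmf_objective_add -!addrA gerDl.
pose c i k := (V *m W *m W^T) i k / V i k.
have c_ge i k : eps ^+ 2 <= c i k.
  by rewrite ler_pdivlMr // mulrC denominator_ge.
have quad : mxdot D (D *m (W *m W^T)) <= \sum_i \sum_k D i k ^+ 2 * c i k.
  apply: ler_sum => i _; under eq_bigr do rewrite [X in _ * X]mxE.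
  under [leRHS]eq_bigr do rewrite /c -mulmxA [X in X / _]mxE.
  apply: (quadratic_form_le_diag _ (W *m W^T) (V i) (D i)) => // k l.
    by rewrite !mxE; apply: eq_bigr => j _; rewrite !mxE mulrC.
  by rewrite (le_trans (sqr_ge0 eps)) // gram_ge.
have decr : eps ^+ 2 * mxdot D D <= \sum_i \sum_k D i k ^+ 2 * c i k.
  rewrite mulr_sumr; apply: ler_sum => i _; rewrite mulr_sumr.
  by apply: ler_sum => k _; rewrite mulrC -expr2 ler_wpM2l ?sqr_ge0.
(* Summing [majorant_minimizer] over the entries leaves a full copy of the weighted square as gain.
   With [quad] for the true quadratic term and [decr] for the gain, the claim is linear. *)
have lin : mxdot D (V *m W *m W^T - M *m W^T) *+ 2 +
    \sum_i \sum_k D i k ^+ 2 * c i k <= - (\sum_i \sum_k D i k ^+ 2 * c i k).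
  rewrite -sumrMnl -big_split /= -sumrN; apply: ler_sum => i _.
  rewrite -sumrMnl -big_split /= -sumrN; apply: ler_sum => k _.
  have Q0 : 0 < (V *m W *m W^T) i k.
    apply: lt_le_trans (denominator_ge _ _ _ _ _ n0 eps0 Vge Wge).
    by rewrite mulr_gt0 ?exprn_gt0.
  rewrite [D i k]mxE [(- V) i k]mxE.
  have -> : (V *m W *m W^T - M *m W^T) i k =
      (V *m W *m W^T) i k - (M *m W^T) i k by rewrite !mxE.
  apply: (majorant_minimizer eps) => //.
  by rewrite mxE.
lra.
Qed.

Lemma updateW_decrease {m n r : nat} (eps : R) (M : 'M[R]_(m, n))
    (V : 'M[R]_(m, r)) (W : 'M[R]_(r, n)) :
  (0 < m)%N -> 0 < eps -> entrywise_ge eps V -> entrywise_ge eps W ->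
  nmf_objective M V (updateW eps M V W) +
    eps ^+ 2 * mxdot (updateW eps M V W - W) (updateW eps M V W - W) <=
  nmf_objective M V W.
Proof.
move=> m0 eps0 Vge Wge; rewrite -!(nmf_objective_trmx M) -mxdot_trmx.
rewrite linearB /= updateW_trmx trmxK.
by apply: updateV_decrease => //; exact: entrywise_ge_trmx.
Qed.

Lemma updateW_ge {m n r : nat} (eps : R) (M : 'M[R]_(m, n))
    (V : 'M[R]_(m, r)) (W : 'M[R]_(r, n)) :
  entrywise_ge eps (updateW eps M V W).
Proof. by move=> i k; rewrite mxE le_max lexx. Qed.

Lemma nmf_objective_nincr {m n r : nat} (M : 'M[R]_(m, n))
    (V V' : 'M[R]_(m, r)) (W W' : 'M[R]_(r, n)) :
  nmf_objective M V' W' <= nmf_objective M V W ->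
  frobenius (M - V' *m W') <= frobenius (M - V *m W).
Proof. by rewrite !nmf_objectiveE => ?; exact: ler_wsqrtr. Qed.

Lemma nmf_objective_empty {m n r : nat} (M : 'M[R]_(m, n))
    (V V' : 'M[R]_(m, r)) (W W' : 'M[R]_(r, n)) :
  (m == 0%N) || (n == 0%N) -> nmf_objective M V W = nmf_objective M V' W'.
Proof.
move=> mn; congr (frobenius _ ^+ 2); apply/matrixP => i j.
case/orP: mn => /eqP mn; exfalso; first by case: i => i; rewrite mn.
by case: j => j; rewrite mn.
Qed.

Lemma updateV_nincr {m n r : nat} (eps : R) (M : 'M[R]_(m, n))
    (V : 'M[R]_(m, r)) (W : 'M[R]_(r, n)) :
  0 < eps -> entrywise_ge eps V -> entrywise_ge eps W ->
  nmf_objective M (updateV eps M V W) W <= nmf_objective M V W.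
Proof.
(* Without columns the denominators are 0, so this case rests on the constancy of the objective. *)
move=> eps0 Vge Wge; have [n0|] := posnP n.
  by rewrite (nmf_objective_empty _ _ V _ W) // n0 orbT.
move=> n0; apply: le_trans (updateV_decrease eps M V W n0 eps0 Vge Wge).
by rewrite lerDl mulr_ge0 ?sqr_ge0 ?mxdot_ge0.
Qed.

Lemma updateW_nincr {m n r : nat} (eps : R) (M : 'M[R]_(m, n))
    (V : 'M[R]_(m, r)) (W : 'M[R]_(r, n)) :
  0 < eps -> entrywise_ge eps V -> entrywise_ge eps W ->
  nmf_objective M V (updateW eps M V W) <= nmf_objective M V W.
Proof.
move=> eps0 Vge Wge; rewrite -!(nmf_objective_trmx M) updateW_trmx trmxK.
by apply: updateV_nincr => //; exact: entrywise_ge_trmx.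
Qed.

(** * Fixed points of the updates satisfy the KKT conditions *)

Lemma updateV_fixed_KKT {m n r : nat} (eps : R) (M : 'M[R]_(m, n))
    (V : 'M[R]_(m, r)) (W : 'M[R]_(r, n)) :
  (0 < n)%N -> 0 < eps -> entrywise_ge eps V -> entrywise_ge eps W ->
  updateV eps M V W = V ->
  bound_KKT eps (fun X => nmf_objective M X W) V.
Proof.
move=> n0 eps0 Vge Wge fixV; rewrite /bound_KKT nmf_gradient.
have KKT i k : 0 <= (V *m W *m W^T) i k - (M *m W^T) i k /\
    (V i k - eps) * ((V *m W *m W^T) i k - (M *m W^T) i k) = 0.
  have V0 : 0 < V i k by exact: lt_le_trans eps0 (Vge i k).
  have := denominator_ge eps V W i k n0 eps0 Vge Wge.
  move/matrixP/(_ i k): fixV; rewrite mxE.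
  move: ((M *m W^T) i k) ((V *m W *m W^T) i k) => b a Vik le_a.
  have a0 : 0 < a by rewrite (lt_le_trans _ le_a) // mulr_gt0 ?exprn_gt0.
  (* Complementarity is the case split of the max: either the ratio [b / a] is 1 and the gradient
     entry vanishes, or the entry equals [eps], the ratio is below 1 and the gradient entry is
     positive. *)
  move: Vik; have [_ Vik|ltx Vik] := leP eps (V i k * (b / a)).
    suff -> : b = a by rewrite subrr mulr0.
    have /(mulfI (lt0r_neq0 V0)) : V i k * (b / a) = V i k * 1 by rewrite mulr1.
    by move/divr1_eq.
  rewrite -Vik subrr mul0r; split=> //; move: ltx.
  rewrite -Vik gtr_pMr // ltr_pdivrMr // mul1r subr_ge0; exact: ltW.
have GE i k : ((V *m W *m W^T - M *m W^T) *+ 2) i k =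
    ((V *m W *m W^T) i k - (M *m W^T) i k) *+ 2 by rewrite mulmxnE !mxE.
split=> // i k; rewrite GE.
  by have [+ _] := KKT i k; exact: mulrn_wge0.
by have [_ +] := KKT i k; rewrite mulrnAr => ->; rewrite mul0rn.
Qed.

Lemma bound_KKT_cst {m n : nat} (eps : R) (f : 'M[R]_(m, n) -> R)
    (A : 'M[R]_(m, n)) :
  entrywise_ge eps A -> (forall B, f B = f A) -> bound_KKT eps f A.
Proof.
move=> Age fcst; have G0 : mx_gradient f A = 0.
  apply/matrixP => i j; rewrite !mxE.
  apply: (@derive_quadratic _ _ _ _ _ _ 0) => h.
  by rewrite fcst !mulr0 !addr0.
by rewrite /bound_KKT G0; split=> // i j; rewrite mxE ?mulr0.
Qed.

Lemma updateW_fixed_KKT {m n r : nat} (eps : R) (M : 'M[R]_(m, n))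
    (V : 'M[R]_(m, r)) (W : 'M[R]_(r, n)) :
  (0 < m)%N -> 0 < eps -> entrywise_ge eps V -> entrywise_ge eps W ->
  updateW eps M V W = W ->
  bound_KKT eps (fun Y => nmf_objective M V Y) W.
Proof.
move=> m0 eps0 Vge Wge fixW.
have := updateV_fixed_KKT eps M^T W^T V^T m0 eps0 _ _ _.
rewrite /bound_KKT.
(* The partial derivatives match because the difference quotients of the transposed problem are the
   same functions of [h]. *)
have -> : mx_gradient (fun X => nmf_objective M^T X V^T) W^T =
    (mx_gradient (fun Y => nmf_objective M V Y) W)^T.
  apply/matrixP => j k; rewrite !mxE.
  rewrite /derive.
  congr (lim (_ @ 0^')); apply/funext => h /=.
  by rewrite -trmx_delta -linearZ -linearD /= !nmf_objective_trmx.
case.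
- exact: entrywise_ge_trmx.
- exact: entrywise_ge_trmx.
- by rewrite -{2}fixW updateW_trmx trmxK.
move=> _ G0 GC; split=> // k j.
  by have := G0 j k; rewrite [X in _ <= X]mxE.
by have := GC j k; rewrite ![_^T _ _]mxE.
Qed.
End Descent.

(** * Entrywise limits and continuity of the updates *)

Section Limits.
Context {R : realType}.

Definition cvg_entries {m n : nat} (A_ : nat -> 'M[R]_(m, n))
    (A : 'M[R]_(m, n)) : Prop :=
  forall i j, A_ k i j @[k --> \oo] --> A i j.

(** Reduces to sums and absolute values, the maximum being half of the sum plus the absolute
    difference. *)
Lemma cvg_maxl {T : Type} (F : set_system T) {FF : Filter F} (f : T -> R)
    (a c : R) :
  f x @[x --> F] --> a -> Num.max c (f x) @[x --> F] --> Num.max c a.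
Proof.
move=> fa; rewrite maxr_absE; under eq_cvg do rewrite maxr_absE.
apply: cvgM; last exact: cvg_cst.
apply: cvgD; first by apply: cvgD => //; exact: cvg_cst.
by apply: cvg_norm; apply: cvgB => //; exact: cvg_cst.
Qed.

Lemma cvg_entries_trmx {m n : nat} (A_ : nat -> 'M[R]_(m, n)) A :
  cvg_entries A_ A -> cvg_entries (fun k => (A_ k)^T) A^T.
Proof.
by move=> cA i j; rewrite mxE; under eq_cvg do rewrite mxE; exact: cA.
Qed.

Lemma cvg_entries_cst {m n : nat} (A : 'M[R]_(m, n)) :
  cvg_entries (fun=> A) A.
Proof. by move=> i j; exact: cvg_cst. Qed.

Lemma cvg_entries_mulmx {m n p : nat} (A_ : nat -> 'M[R]_(m, n)) A
    (B_ : nat -> 'M[R]_(n, p)) B :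
  cvg_entries A_ A -> cvg_entries B_ B ->
  cvg_entries (fun k => A_ k *m B_ k) (A *m B).
Proof.
move=> cA cB i j; rewrite mxE; under eq_cvg do rewrite mxE.
apply: cvg_big => [|l _]; first exact: add_continuous.
by apply: cvgM; [exact: cA|exact: cB].
Qed.

Lemma cvg_entries_ge {m n : nat} (c : R) (A_ : nat -> 'M[R]_(m, n)) A :
  (forall k, entrywise_ge c (A_ k)) -> cvg_entries A_ A -> entrywise_ge c A.
Proof.
by move=> Age cA i j; apply: cvgr_to_ge (cA i j) _; near=> k; exact: Age.
Unshelve. all: by end_near. Qed.

(** The bounds on the limit keep the limiting denominator positive, so the quotient passes to the
    limit. *)
Lemma cvg_entries_updateV {m n r : nat} (eps : R) (M : 'M[R]_(m, n))
    (V_ : nat -> 'M[R]_(m, r)) (W_ : nat -> 'M[R]_(r, n)) V W :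
  (0 < n)%N -> 0 < eps -> entrywise_ge eps V -> entrywise_ge eps W ->
  cvg_entries V_ V -> cvg_entries W_ W ->
  cvg_entries (fun k => updateV eps M (V_ k) (W_ k)) (updateV eps M V W).
Proof.
move=> n0 eps0 Vge Wge cV cW i k; rewrite mxE; under eq_cvg do rewrite mxE.
have cWT := cvg_entries_trmx _ _ cW.
apply: cvg_maxl; apply: cvgM; first exact: cV.
apply: cvgM.
  exact: (cvg_entries_mulmx _ _ _ _ (cvg_entries_cst M) cWT).
apply: cvgV.
  rewrite gt_eqF //.
  apply: lt_le_trans (denominator_ge _ _ _ _ _ n0 eps0 Vge Wge).
  by rewrite mulr_gt0 ?exprn_gt0 // (lt_le_trans eps0).
exact: (cvg_entries_mulmx _ _ _ _ (cvg_entries_mulmx _ _ _ _ cV cW) cWT).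
Qed.

Lemma cvg_entries_updateW {m n r : nat} (eps : R) (M : 'M[R]_(m, n))
    (V_ : nat -> 'M[R]_(m, r)) (W_ : nat -> 'M[R]_(r, n)) V W :
  (0 < m)%N -> 0 < eps -> entrywise_ge eps V -> entrywise_ge eps W ->
  cvg_entries V_ V -> cvg_entries W_ W ->
  cvg_entries (fun k => updateW eps M (V_ k) (W_ k)) (updateW eps M V W).
Proof.
move=> m0 eps0 Vge Wge cV cW i k.
under eq_cvg do rewrite updateW_trmx; rewrite updateW_trmx.
by apply/cvg_entries_trmx/cvg_entries_updateV => //;
  (exact: entrywise_ge_trmx || exact: cvg_entries_trmx).
Qed.

Lemma cvg_subseq (phi : nat -> nat) :
  increasing_seq phi -> phi k @[k --> \oo] --> \oo.
Proof.
move=> /increasing_seqP phi_lt; have phi_ge k : (k <= phi k)%N.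
  by elim: k => // k /leq_ltn_trans; apply; exact: phi_lt.
apply/cvgnyPge => A; near=> k; apply: leq_trans (phi_ge k).
by near: k; exact: nbhs_infty_ge.
Unshelve. all: by end_near. Qed.

(** By monotone convergence [F] has a limit, which its shift shares. *)
Lemma cvg_decrement0 (F : nat -> R) :
  (forall k, F k.+1 <= F k) -> (forall k, 0 <= F k) ->
  F k - F k.+1 @[k --> \oo] --> 0.
Proof.
move=> F_nincr F_ge0; have cF : cvgn F.
  apply: nonincreasing_is_cvgn; first exact/nonincreasing_seqP.
  by exists 0 => _ [k _ <-].
rewrite -(subrr (limn F)); apply: cvgB => //.
by rewrite cvg_shiftS.
Qed.

(** Each squared entry of the difference is squeezed below [e], so its limit is at most 0. *)
Lemma cvg_entries_eq {m n : nat} (A_ B_ : nat -> 'M[R]_(m, n)) A B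
    (e : nat -> R) :
  cvg_entries A_ A -> cvg_entries B_ B -> e k @[k --> \oo] --> 0 ->
  (forall k, mxdot (A_ k - B_ k) (A_ k - B_ k) <= e k) -> A = B.
Proof.
move=> cA cB e0 le_e; apply/matrixP => i j; apply/eqP.
rewrite -subr_eq0 -sqrf_eq0 eq_le sqr_ge0 andbT.
have cAB : (A_ k i j - B_ k i j) ^+ 2 @[k --> \oo] --> (A i j - B i j) ^+ 2.
  by rewrite expr2; under eq_cvg do rewrite expr2; apply: cvgM; apply: cvgB.
apply: ler_cvg_to cAB e0 _; near=> k; apply: le_trans (le_e k).
by have := sqr_le_mxdot (A_ k - B_ k) i j; rewrite !mxE.
Unshelve. all: by end_near. Qed.

(** * Limit points of the iterates *)

Context {m n r : nat} (eps : R) (M : 'M[R]_(m, n)).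
Context (eps0 : 0 < eps) (V0 : 'M[R]_(m, r)) (W0 : 'M[R]_(r, n)).
Context (V0ge : entrywise_ge eps V0) (W0ge : entrywise_ge eps W0).

Let V_ k := (nmf_seq eps M V0 W0 k).1.
Let W_ k := (nmf_seq eps M V0 W0 k).2.

Lemma nmf_seq_ge k : entrywise_ge eps (V_ k) /\ entrywise_ge eps (W_ k).
Proof.
case: k => [//|k]; split; [exact: updateV_ge|exact: updateW_ge].
Qed.

Lemma nmf_limit_fixed (phi : nat -> nat) V W :
  (0 < m)%N -> (0 < n)%N -> increasing_seq phi ->
  cvg_entries (V_ \o phi) V -> cvg_entries (W_ \o phi) W ->
  updateV eps M V W = V /\ updateW eps M V W = W.
Proof.
move=> m0 n0 phi_incr cV cW.
pose F k := nmf_objective M (V_ k) (W_ k).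
have V_ge k := (nmf_seq_ge k).1; have W_ge k := (nmf_seq_ge k).2.
have Vge : entrywise_ge eps V by apply: cvg_entries_ge cV => k; exact: V_ge.
have Wge : entrywise_ge eps W by apply: cvg_entries_ge cW => k; exact: W_ge.
have decV k := updateV_decrease eps M (V_ k) (W_ k) n0 eps0 (V_ge k) (W_ge k).
(* Taken at [V_ k.+1], since the [W]-update uses the new left factor; the intermediate objective
   value then cancels against the one in [decV]. *)
have decW k :=
  updateW_decrease eps M (V_ k.+1) (W_ k) m0 eps0 (V_ge k.+1) (W_ge k).
have stepV_ge0 k := mxdot_ge0 (V_ k.+1 - V_ k).
have stepW_ge0 k := mxdot_ge0 (W_ k.+1 - W_ k).
have eps20 : 0 < eps ^+ 2 by rewrite exprn_gt0.
have dec k : eps ^+ 2 * (mxdot (V_ k.+1 - V_ k) (V_ k.+1 - V_ k) +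
    mxdot (W_ k.+1 - W_ k) (W_ k.+1 - W_ k)) <= F k - F k.+1.
  rewrite mulrDr lerBrDr; apply: le_trans (decV k).
  rewrite addrC addrA addrAC lerD2r; exact: (decW k).
have stepE k : mxdot (V_ k.+1 - V_ k) (V_ k.+1 - V_ k) +
    mxdot (W_ k.+1 - W_ k) (W_ k.+1 - W_ k) <= (F k - F k.+1) / eps ^+ 2.
  by rewrite ler_pdivlMr // mulrC dec.
have e0 : (F (phi k) - F (phi k).+1) / eps ^+ 2 @[k --> \oo] --> 0.
  rewrite -(mul0r (eps ^+ 2)^-1); apply: cvgM; last exact: cvg_cst.
  have F0 : F k - F k.+1 @[k --> \oo] --> 0.
    apply: cvg_decrement0 => k; last by rewrite /F nmf_objectiveE mxdot_ge0.
    rewrite -subr_ge0 (le_trans _ (dec k)) //.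
    by rewrite mulr_ge0 ?addr_ge0 ?(ltW eps20).
  exact: cvg_comp (cvg_subseq _ phi_incr) F0.
(* The successors along [phi] converge to the update of the limit by continuity, and to the limit
   itself because the steps vanish. *)
have cV' : cvg_entries (fun k => V_ (phi k).+1) (updateV eps M V W).
  exact: cvg_entries_updateV.
have fixV : updateV eps M V W = V.
  apply: cvg_entries_eq cV' cV e0 _ => k.
  by apply: le_trans (stepE _); rewrite lerDl.
(* The new left factors also tend to [V], so the limit of the [W]-updates is the update at
   [(V, W)]. *)
split=> //; rewrite fixV in cV'.
have cW' : cvg_entries (fun k => W_ (phi k).+1) (updateW eps M V W).
  exact: cvg_entries_updateW.
apply: cvg_entries_eq cW' cW e0 _ => k.
by apply: le_trans (stepE _); rewrite lerDr.
Qed.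

Lemma nmf_limit_stationary V W :
  subseq_limit (nmf_seq eps M V0 W0) (V, W) -> nmf_stationary eps M V W.
Proof.
case=> phi phi_incr cVW.
have cV : cvg_entries (V_ \o phi) V.
  move=> i k; have cV : V_ (phi l) @[l --> \oo] --> V.
    exact: (cvg_comp _ _ cVW (@cvg_fst _ _ (nbhs V) (nbhs W) _)).
  exact: (cvg_comp _ _ cV (@coord_continuous R m r i k V)).
have cW : cvg_entries (W_ \o phi) W.
  move=> k j; have cW : W_ (phi l) @[l --> \oo] --> W.
    exact: (cvg_comp _ _ cVW (@cvg_snd _ _ (nbhs V) (nbhs W) _)).
  exact: (cvg_comp _ _ cW (@coord_continuous R r n k j W)).
have Vge : entrywise_ge eps V.
  by apply: cvg_entries_ge cV => k; have [] := nmf_seq_ge (phi k).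
have Wge : entrywise_ge eps W.
  by apply: cvg_entries_ge cW => k; have [] := nmf_seq_ge (phi k).
(* In the empty case limit points need not be fixed by the updates, but every feasible point is
   stationary for a constant objective. *)
have [mn0|] := boolP ((m == 0%N) || (n == 0%N)).
  by split; apply: bound_KKT_cst => // B; exact: nmf_objective_empty.
rewrite negb_or -!lt0n => /andP[m0 n0].
have [fixV fixW] := nmf_limit_fixed phi V W m0 n0 phi_incr cV cW.
by split; [exact: updateV_fixed_KKT|exact: updateW_fixed_KKT].
Qed.

End Limits.

Theorem theorem2 (R : realType) (m n r : nat) (M : 'M[R]_(m, n))
    (M_ge0 : entrywise_ge 0 M) (eps : R) (eps_gt0 : 0 < eps) :
  (forall (V : 'M[R]_(m, r)) (W : 'M[R]_(r, n)),
     entrywise_ge eps V -> entrywise_ge eps W ->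
     frobenius (M - updateV eps M V W *m W) <= frobenius (M - V *m W) /\
     frobenius (M - V *m updateW eps M V W) <= frobenius (M - V *m W)) /\
  (forall (V0 : 'M[R]_(m, r)) (W0 : 'M[R]_(r, n)),
     entrywise_ge eps V0 -> entrywise_ge eps W0 ->
     forall (V : 'M[R]_(m, r)) (W : 'M[R]_(r, n)),
       subseq_limit (nmf_seq eps M V0 W0) (V, W) ->
       nmf_stationary eps M V W).
Proof.
split=> [V W Vge Wge|V0 W0 V0ge W0ge V W]; last exact: nmf_limit_stationary.
by split; apply: nmf_objective_nincr;
  [exact: updateV_nincr|exact: updateW_nincr].
Qed.
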